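(* If $u_1\neq u_2$, then every $f\in C_c^2(S^2;D_1)$ can be recovered from $\mathcal{L}f$, $\mathcal{L}^1f$ and $\mathcal{T}f$; that is, if $f,\tilde f\in C_c^2(S^2;D_1)$ satisfy $\mathcal{L}f=\mathcal{L}\tilde f$, $\mathcal{L}^1f=\mathcal{L}^1\tilde f$ and $\mathcal{T}f=\mathcal{T}\tilde f$ on $\mathbb{R}^2$, then $f=\tilde f$.
   Context: $D_1\subset\mathbb{R}^2$ is an open disc of radius $r_1>0$ centered at the origin. $C_c^2(S^2;D_1)$ is the space of symmetric $2$-tensor fields $f=(f_{ij})_{i,j=1,2}$, $f_{12}=f_{21}$, whose components are twice continuously differentiable and compactly supported in $D_1$ (extended by zero to $\mathbb{R}^2$). For symmetric $2$-tensors, $\langle f,g\rangle=f_{11}g_{11}+2f_{12}g_{12}+f_{22}g_{22}$. For a vector $a\in\mathbb{R}^2$, $(a^2)_{ij}=a_ia_j$ and $a^\perp=(-a_2,a_1)$. For a unit vector $a$, an integer $k\ge0$ and a compactly supported function $h$, $\mathcal{X}^k_a h(x)=\int_0^\infty h(x+ta)\,t^k\,dt$ and $\mathcal{X}_a=\mathcal{X}_a^0$. Fix unit vectors $u=(u_1,u_2)$ and $v=(-u_1,u_2)$ with $u_1,u_2>0$ (so $u,v$ are linearly independent, and they are orthogonal exactly when $u_1=u_2$). Define the functions on $\mathbb{R}^2$ $$\mathcal{L}f=\mathcal{X}_u\langle f,u^2\rangle+\mathcal{X}_v\langle f,v^2\rangle,\quad \mathcal{L}^1f=\mathcal{X}^1_u\langle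 f,u^2\rangle+\mathcal{X}^1_v\langle f,v^2\rangle,\quad \mathcal{T}f=\mathcal{X}_u\langle f,(u^\perp)^2\rangle+\mathcal{X}_v\langle f,(v^\perp)^2\rangle$$ (longitudinal, first moment longitudinal and transverse V-line transforms). (Their values on a sufficiently large closed disc centered at the origin determine them on all of $\mathbb{R}^2$.) *)

(* Defs.v *)
From mathcomp Require Import all_boot all_order all_algebra.
From mathcomp Require Import all_classical all_reals all_analysis.

Set Implicit Arguments.
Unset Strict Implicit.
Unset Printing Implicit Defensive.

Import Order.TTheory GRing.Theory Num.Theory.
Import numFieldNormedType.Exports.

Local Open Scope classical_set_scope.
Local Open Scope ring_scope.

Section Definitions.
Context {R : realType}.
Local Notation plane := 'rV[R]_2.

Definition vec2 (a b : R) : plane := \row_(j < 2) (if j == 0 then a else b).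

Definition perp (a : plane) : plane := vec2 (- a 0 1) (a 0 0).

(* The library norm on row vectors is the max norm, so the Euclidean norm is
   spelled out. *)
Definition open_disc (r : R) : set plane :=
  [set x | Num.sqrt (x 0 0 ^+ 2 + x 0 1 ^+ 2) < r].

(* C^k on the whole plane; [delta_mx 0 i] is the i-th standard basis vector, so
   the derivatives below are the partial derivatives. *)
Fixpoint Ck (k : nat) (h : plane -> R) : Prop :=
  continuous h /\
  (if k is k'.+1 then
     forall i : 'I_2,
       (forall x, derivable h x (delta_mx 0 i)) /\
       Ck k' ('D_(delta_mx 0 i) h)
   else True).

Definition compactly_supported_in (D : set plane) (h : plane -> R) : Prop :=
  compact (closure [set x | h x != 0]) /\ closure [set x | h x != 0] `<=` D.

Definition Cc2_sym_tensor (D : set plane) : set (plane -> 'M[R]_2) :=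
  [set f | (forall x, f x 0 1 = f x 1 0) /\
           (forall i j : 'I_2, Ck 2 (fun x => f x i j) /\
                               compactly_supported_in D (fun x => f x i j))].

Definition tensor_sq (a : plane) : 'M[R]_2 := \matrix_(i, j) (a 0 i * a 0 j).

Definition tensor_dot (f g : 'M[R]_2) : R :=
  f 0 0 * g 0 0 + 2 * f 0 1 * g 0 1 + f 1 1 * g 1 1.

Definition moment_beam (k : nat) (a : plane) (h : plane -> R) (x : plane) : R :=
  \int[lebesgue_measure]_(t in `[0, +oo[) (h (x + t *: a) * t ^+ k).

Definition moment_longitudinal (k : nat) (u v : plane) (f : plane -> 'M[R]_2)
    (x : plane) : R :=
  moment_beam k u (fun y => tensor_dot (f y) (tensor_sq u)) x +
  moment_beam k v (fun y => tensor_dot (f y) (tensor_sq v)) x.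

Definition longitudinal := moment_longitudinal 0.

Definition longitudinal1 := moment_longitudinal 1.

Definition transverse (u v : plane) (f : plane -> 'M[R]_2) (x : plane) : R :=
  moment_beam 0 u (fun y => tensor_dot (f y) (tensor_sq (perp u))) x +
  moment_beam 0 v (fun y => tensor_dot (f y) (tensor_sq (perp v))) x.

End Definitions.

(* Main.v *)
Require Import Defs.
From mathcomp Require Import all_boot all_order all_algebra.
From mathcomp Require Import all_classical all_reals all_analysis.
From mathcomp Require Import ring lra.

Set Implicit Arguments.
Unset Strict Implicit.
Unset Printing Implicit Defensive.

Import Order.TTheory GRing.Theory Num.Theory.
Import numFieldNormedType.Exports.

Local Open Scope classical_set_scope.
Local Open Scope ring_scope.

(** Write F = f - g, X_a and X^1_a for the beam transforms of order 0 and 1,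
    D_a for the derivative along a, and P, Q for the values of F on u^2 and v^2.

    A beam transform inverts a directional derivative: D_a X_a h = - h and
    D_a X^1_a h = - X_a h ([is_derive_beam], [is_derive_beam1]). If
    X_u P + X_v Q = 0, the single function W = X_u P = - X_v Q therefore has
    D_u W = - P and D_v W = Q, so that its mixed derivatives are - D_v P and
    D_u Q; as they are continuous they agree, and D_v P + D_u Q = 0
    ([vline_derive]). If moreover X^1_u P + X^1_v Q = 0, then
    Z = X^1_u P = - X^1_v Q has D_u Z = D_v Z = - W, its mixed derivatives are
    - Q and P, and P + Q = 0 ([vline_moments_sum]).

    For the tensor field F, P + Q = 2 (u1^2 F11 + u2^2 F22), so the two
    longitudinal transforms give u1^2 F11 + u2^2 F22 = 0. What remains of P and
    Q is 2 u1 u2 F12 and its opposite, and D_v P + D_u Q = 0 becomes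
    d/dx1 F12 = 0, whence F12 = 0 by compactness of the support. The transverse
    transform now involves the same function u2^2 F11 + u1^2 F22 on both
    branches, which by the relation between F11 and F22 is
    ((u2^2 - u1^2) / u2^2) F11; since D_u + D_v = 2 u2 d/dx2 it follows that
    d/dx2 F11 = 0, the hypothesis u1 <> u2 being what makes the coefficient
    nonzero. So F11 = 0, and then F22 = 0.

    Indices 1 and 2 above are 0 and 1 in the code. The statements about W and Z
    are made for differences of transforms of f and g, to avoid the
    integrability conditions behind linearity of the integral. *)

(** * Directional derivatives *)

Section Directional.
Context {R : realType} {V : normedModType R}.
Implicit Types (f : V -> R) (x u v : V).

(** Together with its converse at the origin of the line, this reduces
    directional derivatives to the one-variable calculus of the mean value
    theorem and of the chain rule. *)
Lemma is_derive_line f x v (t d : R) :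
  is_derive (x + t *: v) v f d -> is_derive t 1 (fun s : R => f (x + s *: v)) d.
Proof.
move=> [df dfE].
have E : (fun h : R => h^-1 *: (f (x + (h *: 1 + t) *: v) - f (x + t *: v))) =
  (fun h : R => h^-1 *: (f (h *: v + (x + t *: v)) - f (x + t *: v))).
  apply/funext => h; congr (_ *: (f _ - _)).
  by rewrite [h *: 1]mulr1 scalerDl addrCA.
by apply: DeriveDef; [rewrite /derivable E|rewrite /derive E].
Qed.

Lemma is_derive_from_line f x v (d : R) :
  is_derive (0 : R) 1 (fun s : R => f (x + s *: v)) d -> is_derive x v f d.
Proof.
move=> [df dfE].
have E : (fun h : R =>
    h^-1 *: (f (x + (h *: 1 + 0 : R) *: v) - f (x + (0 : R) *: v))) =
  (fun h : R => h^-1 *: (f (h *: v + x) - f x)).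
  apply/funext => h; rewrite scale0r !addr0; congr (_ *: (f _ - _)).
  by rewrite [h *: 1]mulr1 addrC.
by apply: DeriveDef; move: df dfE; rewrite /derivable /derive E.
Qed.

Lemma is_derive_scaledir f x v (c d : R) :
  is_derive x v f d -> is_derive x (c *: v) f (c * d).
Proof.
move=> fd; apply: is_derive_from_line.
have fd0 : is_derive (c * 0) 1 (fun s : R => f (x + s *: v)) d.
  by apply: is_derive_line; rewrite mulr0 scale0r addr0.
have -> : (fun s : R => f (x + s *: (c *: v))) =
    (fun s : R => f (x + s *: v)) \o (fun s => c * s).
  by apply/funext => s /=; rewrite scalerA (mulrC s).
rewrite mulrC; apply: is_derive1_comp => //.
rewrite -[X in is_derive _ _ _ X]mulr1.
exact: (is_deriveZ c (is_derive_id (0 : R) 1)).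
Qed.

(** The mean value theorem along a line, for steps of either sign: a negative
    step along v is a positive step along - v. *)
Lemma MVT_dir f df x v (h : R) :
  (forall y, is_derive y v f (df y)) ->
  exists2 c, `|c| <= `|h| & f (x + h *: v) - f x = h * df (x + c *: v).
Proof.
have pos w dg (k : R) : 0 < k -> (forall y, is_derive y w f (dg y)) ->
    exists2 c, `|c| <= `|k| & f (x + k *: w) - f x = k * dg (x + c *: w).
  move=> k0 fdg.
  have D (t : R) : is_derive t 1 (fun s : R => f (x + s *: w)) (dg (x + t *: w)).
    exact: is_derive_line.
  have [|c] := @MVT R (fun s : R => f (x + s *: w))
      (fun s : R => dg (x + s *: w)) 0 k k0 (fun t _ => D t).
    apply: continuous_subspaceT => t.
    by apply: differentiable_continuous; apply/derivable1_diffP.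
  rewrite in_itv /= scale0r addr0 subr0 => /andP[c0 ck] ->.
  by exists c; [rewrite !gtr0_norm// ltW|rewrite mulrC].
move=> fdf; case: (ltgtP h 0) => [h0|h0|->].
- have [||c ch] := @pos (- v) (fun y => - df y) (- h); first by rewrite oppr_gt0.
    by move=> y; rewrite -scaleN1r -[- df y]mulN1r; exact: is_derive_scaledir.
  rewrite scaleNr scalerN opprK mulrNN => ->; exists (- c).
    by rewrite normrN -[`|h|]normrN.
  by rewrite scaleNr scalerN.
- exact: pos.
- by exists 0; rewrite ?normr0// scale0r addr0 subrr mul0r.
Qed.

Lemma near_affine (g : V -> R) x u v (e : R) : {for x, continuous g} -> 0 < e ->
  exists2 d : R, 0 < d & forall s t : R, `|s| <= d -> `|t| <= d ->
    `|g x - g (x + s *: u + t *: v)| < e.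
Proof.
move=> /cvgrPdist_lt cg e0.
have /nbhs_ballP[r /= r0 xr] := cg _ e0.
pose M := `|u| + `|v| + 1.
have M0 : 0 < M by rewrite /M ltr_wpDl// addr_ge0.
exists (r / M); first by rewrite divr_gt0.
move=> s t sd td; apply: xr; rewrite -ball_normE /=.
rewrite -addrA opprD addNKr normrN (le_lt_trans (ler_normD _ _))//.
rewrite !normrZ; have rM : r / M * M = r by rewrite divfK// gt_eqF.
have rM0 : 0 < r / M by rewrite divr_gt0.
rewrite -[ltRHS]rM /M !mulrDr mulr1.
by rewrite ltr_pwDr// lerD// ler_wpM2r.
Qed.

(** Split the increment along u + v into an increment along u at x and an
    increment along v at a nearby point. The mean value theorem turns the second
    into a value of df near x, which continuity of df at x controls. *)
Lemma is_derive_adddir f df x u v (d : R) :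
  is_derive x u f d -> (forall y, is_derive y v f (df y)) ->
  {for x, continuous df} -> is_derive x (u + v) f (d + df x).
Proof.
move=> [fu fuE] fv cdf.
have lim1 : (fun h : R => h^-1 *: (f (h *: u + x) - f x)) @ 0^' --> d.
  by rewrite -fuE; apply: fu.
have lim2 : (fun h : R => h^-1 *: (f (h *: (u + v) + x) - f (h *: u + x)))
    @ 0^' --> df x.
  apply/cvgrPdist_lt => e e0.
  have [r r0 xr] := near_affine u v cdf e0.
  near=> h.
  have h0 : h != 0 by near: h; exact: nbhs_dnbhs_neq.
  have [c ch E] := MVT_dir (x + h *: u) h fv.
  have -> : h *: (u + v) + x = x + h *: u + h *: v.
    by rewrite scalerDr addrC addrA.
  rewrite [h *: u + x]addrC E [_ *: _]mulKf//.
  have hr : `|h| <= r.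
    near: h; apply: nbhs_dnbhs; apply/nbhs_ballP; exists r => //= y.
    by rewrite -ball_normE/= sub0r normrN => /ltW.
  by apply: xr => //; exact: le_trans ch hr.
have : (fun h : R => h^-1 *: (f (h *: (u + v) + x) - f x)) @ 0^' --> d + df x.
  rewrite [d + _]addrC.
  have -> : (fun h : R => h^-1 *: (f (h *: (u + v) + x) - f x)) =
    (fun h : R => h^-1 *: (f (h *: (u + v) + x) - f (h *: u + x))) \+
    (fun h : R => h^-1 *: (f (h *: u + x) - f x)).
    by apply/funext => h /=; rewrite -scalerDr addrA subrK.
  exact: cvgD.
move=> /[dup] lim /cvg_lim E; apply: DeriveDef; last exact: E.
by apply/cvg_ex; eexists; exact: lim.
Unshelve. all: by end_near. Qed.

(** Schwarz's theorem: the mean value theorem applied twice to the second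
    difference of f over the parallelogram spanned by h u and h v gives h^2
    times a value of fuv near x; exchanging u and v gives the same with fvu. *)
Lemma mixed_derive_eq f fu fv fuv fvu x u v :
  (forall y, is_derive y u f (fu y)) -> (forall y, is_derive y v f (fv y)) ->
  (forall y, is_derive y v fu (fuv y)) -> (forall y, is_derive y u fv (fvu y)) ->
  {for x, continuous fuv} -> {for x, continuous fvu} -> fuv x = fvu x.
Proof.
move=> Df1 Df2 Dfu Dfv c1 c2.
have key w z (fw fwz : V -> R) (h : R) : (forall y, is_derive y w f (fw y)) ->
    (forall y, is_derive y z fw (fwz y)) ->
    exists a b, [/\ `|a| <= `|h|, `|b| <= `|h| &
    f (x + h *: w + h *: z) - f (x + h *: w) - (f (x + h *: z) - f x) =
    h * (h * fwz (x + a *: w + b *: z))].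
  move=> Dw Dwz.
  have Dg y : is_derive y w (fun y => f (y + h *: z) - f y)
      (fw (y + h *: z) - fw y).
    apply: is_derive_from_line.
    apply: (@is_deriveB _ _ _ (fun s : R => f (y + s *: w + h *: z))
      (fun s : R => f (y + s *: w))); last first.
      by apply: is_derive_line; rewrite scale0r addr0.
    have -> : (fun s : R => f (y + s *: w + h *: z)) =
      (fun s : R => f (y + h *: z + s *: w)).
      by apply/funext => s; rewrite addrAC.
    by apply: is_derive_line; rewrite scale0r addr0.
  have [a ah Ea] := MVT_dir x h Dg.
  have [b bh Eb] := MVT_dir (x + a *: w) h Dwz.
  by exists a, b; split; rewrite // Ea Eb.
apply/eqP; rewrite -subr_eq0 -normr_le0; apply/ler_addgt0Pr => e e0.
rewrite add0r.
have e20 : 0 < e / 2 by rewrite divr_gt0.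
have [r1 r10 xr1] := near_affine u v c1 e20.
have [r2 r20 xr2] := near_affine v u c2 e20.
pose h := Num.min r1 r2.
have h0 : 0 < h by rewrite lt_min r10.
have [a [b [ah bh E1]]] := key u v fu fuv h Df1 Dfu.
have [a' [b' [ah' bh' E2]]] := key v u fv fvu h Df2 Dfv.
rewrite [`|h|]gtr0_norm// in ah bh ah' bh'.
have E : fuv (x + a *: u + b *: v) = fvu (x + a' *: v + b' *: u).
  have /mulfI : h != 0 by rewrite gt_eqF.
  move=> inj; apply/inj/inj; rewrite -E1 -E2.
  rewrite (addrAC x); ring.
have l1 : h <= r1 by rewrite ge_min lexx.
have l2 : h <= r2 by rewrite ge_min lexx orbT.
have A := xr1 _ _ (le_trans ah l1) (le_trans bh l1).
have B := xr2 _ _ (le_trans ah' l2) (le_trans bh' l2).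
have -> : fuv x - fvu x = (fuv x - fuv (x + a *: u + b *: v)) -
    (fvu x - fvu (x + a' *: v + b' *: u)).
  by rewrite E; ring.
rewrite (le_trans (ler_normB _ _))// [leRHS](splitr e) lerD// ltW//.
Qed.

End Directional.

(** * Beam transforms *)

Section Beam.
Context {R : realType}.
Local Notation plane := 'rV[R]_2.
Local Notation mu := (@lebesgue_measure R).

Lemma Rintegral_FTC2 (p P : R -> R) (T : R) : 0 < T ->
  (forall t, 0 <= t <= T -> {for t, continuous p}) ->
  (forall t, 0 <= t <= T -> is_derive t 1 P (p t)) ->
  \int[mu]_(t in `[0, T]) p t = P T - P 0.
Proof.
move=> T0 cp dP.
have cP t : 0 <= t <= T -> {for t, continuous P}.
  by move=> /dP ?; apply: differentiable_continuous; apply/derivable1_diffP.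
rewrite /Rintegral (@continuous_FTC2 _ p P)//.
- apply: continuous_in_subspaceT => t; rewrite inE/= in_itv/=; exact: cp.
- split.
  + move=> t; rewrite in_itv/= => /andP[/ltW t0 /ltW tT].
    by have := dP t; rewrite t0 tT => /(_ isT) [].
  + by apply: cvg_at_right_filter; apply: cP; rewrite lexx ltW.
  + by apply: cvg_at_left_filter; apply: cP; rewrite lexx ltW.
- move=> t; rewrite in_itv/= => /andP[/ltW t0 /ltW tT].
  by have := dP t; rewrite t0 tT => /(_ isT) ?; rewrite derive1E derive_val.
Qed.

Lemma antiderivative (p : R -> R) (b c : R) : b < c -> continuous p ->
  exists P : R -> R, forall t, b < t < c -> is_derive t 1 P (p t).
Proof.
move=> bc cp.
have ip : mu.-integrable `[b, c] (EFin \o p).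
  apply: continuous_compact_integrable; first exact: segment_compact.
  exact: continuous_subspaceT.
exists (fun x => \int[mu]_(t in `[b, x]) p t) => t /andP[bt tc].
have [D E] := @continuous_FTC1_closed _ p b t c tc ip bt (cp t).
by apply: (DeriveDef D); rewrite -E derive1E.
Qed.

Lemma Rintegral_ray_trunc (p : R -> R) (T : R) : (forall t, T < t -> p t = 0) ->
  \int[mu]_(t in `[0, +oo[) p t = \int[mu]_(t in `[0, T]) p t.
Proof.
move=> pT.
have -> : [set` `[0, T]] = [set` `[0, +oo[] `&` [set` `]-oo, T]] :> set R.
  apply/seteqP; split => t /=; rewrite !in_itv /=; first by move=> /andP[-> ->].
  by rewrite andbT => -[-> ->].
rewrite Rintegral_mkcondr; apply: eq_Rintegral => t _.
rewrite patchE; case: ifPn => // /negP tT; apply: pT; rewrite ltNge.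
by apply/negP => le; apply: tT; rewrite inE/= in_itv/=.
Qed.

Lemma near0_lt1 : \forall s \near (0 : R), -1 < s < 1.
Proof.
apply/nbhs_ballP; exists 1 => //= s; rewrite -ball_normE /= sub0r normrN.
by rewrite ltr_norml.
Qed.

Lemma continuous_line (h : plane -> R) (x a : plane) : continuous h ->
  continuous (fun t : R => h (x + t *: a)).
Proof.
move=> ch t.
apply: (@continuous_comp _ _ _ (fun t : R => x + t *: a) h); last exact: ch.
apply: cvgD; [exact: cvg_cst|exact: scalel_continuous].
Qed.

(** The form of bounded support under which integrals over half-lines of
    direction a reduce to integrals over segments; T may depend on the line. *)
Definition ray_supported (a : plane) (h : plane -> R) :=
  forall x, exists T : R, forall t, T < t -> h (x + t *: a) = 0.

(** The half-line from x + s a is the part beyond s of the line through x, and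
    in the parameter of that line the weight t^k becomes (t - s)^k. Written so,
    the dependence on the base point s is explicit and can be differentiated. *)
Lemma moment_beam_line k (a : plane) (h : plane -> R) (x : plane) (T s : R)
    (P : R -> R) :
  continuous h -> (forall t, T < t -> h (x + t *: a) = 0) -> s < T ->
  (forall t, s <= t <= T -> is_derive t 1 P (h (x + t *: a) * (t - s) ^+ k)) ->
  moment_beam k a h (x + s *: a) = P T - P s.
Proof.
move=> ch hT sT dP; rewrite /moment_beam.
have E t : x + s *: a + t *: a = x + (s + t) *: a by rewrite scalerDl addrA.
rewrite (@Rintegral_ray_trunc _ (T - s)); last first.
  by move=> t; rewrite ltrBlDl => /hT; rewrite E => ->; rewrite mul0r.
have dPs t : 0 <= t <= T - s ->
    is_derive t 1 (fun t => P (s + t)) (h (x + s *: a + t *: a) * t ^+ k).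
  move=> /andP[t0 tT]; rewrite E.
  have -> : (fun t => P (s + t)) = (fun t => P (s + t *: (1 : R))).
    by apply/funext => r; rewrite [_ *: _]mulr1.
  apply: is_derive_line; rewrite [_ *: _]mulr1.
  have := dP (s + t); rewrite [s + t - s]addrAC subrr add0r; apply.
  by rewrite lerDl t0 -lerBrDl.
have sT0 : 0 < T - s by rewrite subr_gt0.
rewrite (Rintegral_FTC2 sT0 _ dPs).
  by rewrite addr0 addrCA subrr addr0.
move=> t _; apply: continuousM; last exact: exprn_continuous.
exact: continuous_line.
Qed.

(** Along the line through x, X_a h is the integral of h from s to a fixed
    point T beyond the support, and s enters only as the lower bound. *)
Lemma is_derive_beam (a : plane) (h : plane -> R) (x : plane) :
  continuous h -> ray_supported a h ->
  is_derive x a (moment_beam 0 a h) (- h x).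
Proof.
move=> ch ha; have [T0 hT0] := ha x.
(* T is at least 1 so that T lies beyond every base point s in ]-1, 1[. *)
pose T := Num.max T0 1.
have hT t : T < t -> h (x + t *: a) = 0 by rewrite gt_max => /andP[/hT0].
have T1 : 1 <= T by rewrite le_max lexx orbT.
have [|P dP] := @antiderivative _ (-1) (T + 1) _ (@continuous_line h x a ch);
  first lra.
have E s : -1 < s < 1 -> moment_beam 0 a h (x + s *: a) = P T - P s.
  move=> /andP[s1 s2]; apply: moment_beam_line => //; first lra.
  by move=> t /andP[t1 t2]; rewrite mulr1; apply: dP; lra.
apply: is_derive_from_line.
apply: (@near_eq_is_derive _ _ _ (cst (P T) - P)).
  near=> s; rewrite E//; near: s; exact: near0_lt1.
have dP0 : is_derive (0 : R) 1 P (h x).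
  have := dP 0; rewrite scale0r addr0; apply; lra.
rewrite -[- h x]sub0r; exact: is_deriveB.
Unshelve. all: by end_near. Qed.

(** With the weight (t - s) the boundary term at t = s vanishes, and only the
    derivative - 1 of the weight contributes. If P and Q are antiderivatives of
    h (x + t a) and t h (x + t a), then Q - s P is one of the integrand. *)
Lemma is_derive_beam1 (a : plane) (h : plane -> R) (x : plane) :
  continuous h -> ray_supported a h ->
  is_derive x a (moment_beam 1 a h) (- moment_beam 0 a h x).
Proof.
move=> ch ha; have [T0 hT0] := ha x.
(* T is at least 1 so that T lies beyond every base point s in ]-1, 1[. *)
pose T := Num.max T0 1.
have hT t : T < t -> h (x + t *: a) = 0 by rewrite gt_max => /andP[/hT0].
have T1 : 1 <= T by rewrite le_max lexx orbT.
have [|P dP] := @antiderivative _ (-1) (T + 1) _ (@continuous_line h x a ch);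
  first lra.
have [||Q dQ] := @antiderivative (fun t => h (x + t *: a) * t) (-1) (T + 1);
  first lra.
  move=> t; apply: continuousM => //; exact: continuous_line.
have E s : -1 < s < 1 -> moment_beam 1 a h (x + s *: a) =
    (Q T - Q s) - s * (P T - P s).
  move=> /andP[s1 s2].
  have dQP t : s <= t <= T ->
      is_derive t 1 (Q - s \*: P) (h (x + t *: a) * (t - s) ^+ 1).
    move=> /andP[t1 t2]; rewrite expr1 mulrBr [_ * s]mulrC.
    have dPt : is_derive t 1 P (h (x + t *: a)) by apply: dP; lra.
    have dQt : is_derive t 1 Q (h (x + t *: a) * t) by apply: dQ; lra.
    exact: is_deriveB.
  rewrite (moment_beam_line ch hT _ dQP); last lra.
  by rewrite !fctE /= /GRing.scale /=; ring.
have -> : moment_beam 0 a h x = P T - P 0.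
  rewrite -[x in LHS]addr0 -(scale0r a); apply: moment_beam_line => //; first lra.
  by move=> t /andP[t1 t2]; rewrite mulr1; apply: dP; lra.
apply: is_derive_from_line.
apply: (@near_eq_is_derive _ _ _ ((cst (Q T) - Q) - id * (cst (P T) - P))).
  near=> s; rewrite E//; near: s; exact: near0_lt1.
have dP0 : is_derive (0 : R) 1 P (h x).
  have := dP 0; rewrite scale0r addr0; apply; lra.
have dQ0 : is_derive (0 : R) 1 Q 0.
  have := dQ 0; rewrite mulr0; apply; lra.
apply: is_derive_eq.
rewrite !fctE /= scale0r !subr0 sub0r add0r [_ *: 1]mulr1 //.
Unshelve. all: by end_near. Qed.

End Beam.

(** * Pairs of functions with the same V-line transforms *)

Section VLine.
Context {R : realType}.
Local Notation plane := 'rV[R]_2.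
Context (u v : plane) (P1 P2 Q1 Q2 : plane -> R).
Context (cP1 : continuous P1) (cP2 : continuous P2).
Context (cQ1 : continuous Q1) (cQ2 : continuous Q2).
Context (sP1 : ray_supported u P1) (sP2 : ray_supported u P2).
Context (sQ1 : ray_supported v Q1) (sQ2 : ray_supported v Q2).
Context (eq0 : forall x, moment_beam 0 u P1 x + moment_beam 0 v Q1 x =
                           moment_beam 0 u P2 x + moment_beam 0 v Q2 x).

Let W := moment_beam 0 u P1 - moment_beam 0 u P2.

Let WE : W = moment_beam 0 v Q2 - moment_beam 0 v Q1.
Proof. by apply/funext => x; rewrite /W !fctE; have := eq0 x; lra. Qed.

Let dWu x : is_derive x u W (P2 x - P1 x).
Proof.
rewrite -[P2 x - P1 x]opprB opprD.
by apply: is_deriveB; exact: is_derive_beam.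
Qed.

Let dWv x : is_derive x v W (Q1 x - Q2 x).
Proof.
rewrite WE -[Q1 x - Q2 x]opprB opprD.
by apply: is_deriveB; exact: is_derive_beam.
Qed.

(** The function W has D_u W = P2 - P1 and D_v W = Q1 - Q2; the conclusion
    is the equality of its mixed derivatives. *)
Lemma vline_derive (dP dQ : plane -> R) :
  (forall x, is_derive x v (P1 - P2) (dP x)) ->
  (forall x, is_derive x u (Q1 - Q2) (dQ x)) ->
  continuous dP -> continuous dQ -> forall x, dP x + dQ x = 0.
Proof.
move=> DP DQ cdP cdQ x; have dWuv y : is_derive y v (P2 - P1) (- dP y).
  by rewrite -[P2 - P1]opprB; exact: is_deriveN.
have <- := @mixed_derive_eq _ _ W (P2 - P1) (Q1 - Q2) (- dP) dQ x u v dWu dWv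
  dWuv DQ (continuousN (cdP x)) (cdQ x).
by rewrite fctE subrr.
Qed.

Context (eq1 : forall x, moment_beam 1 u P1 x + moment_beam 1 v Q1 x =
                           moment_beam 1 u P2 x + moment_beam 1 v Q2 x).

(** Z plays for the first moments the role of W for the beams: both D_u Z and
    D_v Z equal - W, and the mixed derivatives of Z are first derivatives
    of - W, that is P1 - P2 and Q2 - Q1. *)
Lemma vline_moments_sum x : P1 x + Q1 x = P2 x + Q2 x.
Proof.
pose Z := moment_beam 1 u P1 - moment_beam 1 u P2.
have ZE : Z = moment_beam 1 v Q2 - moment_beam 1 v Q1.
  by apply/funext => y; rewrite /Z !fctE; have := eq1 y; lra.
have dZu y : is_derive y u Z (- W y).
  by rewrite /W opprD; apply: is_deriveB; exact: is_derive_beam1.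
have dZv y : is_derive y v Z (- W y).
  by rewrite ZE WE opprD; apply: is_deriveB; exact: is_derive_beam1.
have dWu' y : is_derive y u (- W) (P1 y - P2 y).
  by rewrite -[P1 y - P2 y]opprB; exact: is_deriveN.
have dWv' y : is_derive y v (- W) (Q2 y - Q1 y).
  by rewrite -[Q2 y - Q1 y]opprB; exact: is_deriveN.
have := @mixed_derive_eq _ _ Z (- W) (- W) (Q2 - Q1) (P1 - P2) x u v dZu dZv
  dWv' dWu'.
rewrite !fctE => E.
suff : Q2 x - Q1 x = P1 x - P2 x by lra.
by apply: E; apply: continuousB; [exact: cQ2|exact: cQ1|exact: cP1|exact: cP2].
Qed.

End VLine.

(** * Functions on the plane *)

Section ContinuousCombinations.
Context {R : realType} {T : topologicalType}.
Implicit Types g h : T -> R.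

Lemma continuous_cmul (c : R) g : continuous g -> continuous (fun x => c * g x).
Proof. by move=> cg x; apply: cvgMl_tmp; exact: cg. Qed.

Lemma continuous_add g h :
  continuous g -> continuous h -> continuous (fun x => g x + h x).
Proof. by move=> cg ch x; apply: cvgD; [exact: cg|exact: ch]. Qed.

Lemma continuous_sub g h : continuous g -> continuous h -> continuous (g - h).
Proof. by move=> cg ch x; apply: cvgB; [exact: cg|exact: ch]. Qed.

End ContinuousCombinations.

Section Support.
Context {R : realType}.
Local Notation plane := 'rV[R]_2.
Implicit Types (h : plane -> R) (a : plane).

Lemma ord2P (i : 'I_2) : i = 0 \/ i = 1.
Proof. by case: i => [[|[|]]]//= ?; [left|right]; exact: val_inj. Qed.

Lemma supported_disc r h (x : plane) (i : 'I_2) :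
  compactly_supported_in (open_disc r) h -> r <= x 0 i -> h x = 0.
Proof.
move=> [_ hr] rx; apply/eqP/negPn/negP => hx.
have := hr _ (@subset_closure _ [set y | h y != 0] x hx).
rewrite /open_disc /= ltNge => /negP; apply.
rewrite (le_trans rx)// (le_trans (ler_norm _))// -sqrtr_sqr ler_wsqrtr//.
by have [->|->] := ord2P i; rewrite ?lerDl ?lerDr sqr_ge0.
Qed.

Lemma ray_supported_above r h a : 0 < a 0 1 ->
  (forall x : plane, r <= x 0 1 -> h x = 0) -> ray_supported a h.
Proof.
move=> a0 hr x; exists ((r - x 0 1) / a 0 1) => t.
rewrite ltr_pdivrMr// => ht; apply: hr; rewrite !mxE; lra.
Qed.

Lemma eq0_derive_axis r h (i : 'I_2) :
  (forall x, is_derive x (delta_mx 0 i) h 0) ->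
  (forall x : plane, r <= x 0 i -> h x = 0) -> forall x, h x = 0.
Proof.
move=> dh hr x.
rewrite -[x]addr0 -(scale0r (delta_mx 0 i)).
have dl (t : R) :
    is_derive t (1 : R) (fun t : R => h (x + t *: delta_mx 0 i)) 0.
  exact: is_derive_line.
rewrite (is_derive_0_is_cst 0 (r - x 0 i) dl).
by apply: hr; rewrite !mxE !eqxx mulr1 addrC subrK.
Qed.

Lemma vec2E (a b : R) : vec2 a b = a *: delta_mx 0 0 + b *: delta_mx 0 1.
Proof.
apply/rowP => i; rewrite !mxE !eqxx /=.
by have [->|->] := ord2P i; rewrite /= ?mulr1 ?mulr0 ?addr0 ?add0r.
Qed.

Lemma is_derive_vec2 h (d0 d1 : plane -> R) (a b : R) x :
  (forall x, is_derive x (delta_mx 0 0) h (d0 x)) ->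
  (forall x, is_derive x (delta_mx 0 1) h (d1 x)) ->
  continuous d1 -> is_derive x (vec2 a b) h (a * d0 x + b * d1 x).
Proof.
move=> D0 D1 c1; rewrite vec2E.
have cb1 : continuous (fun y => b * d1 y).
  exact: continuous_cmul.
have Da := is_derive_scaledir a (D0 x).
have Db y := is_derive_scaledir b (D1 y).
exact: (is_derive_adddir Da Db (cb1 x)).
Qed.

End Support.

(** * Tensor fields *)

Section Tensor.
Context {R : realType}.
Local Notation plane := 'rV[R]_2.

Lemma tensor_dot_sq (m : 'M[R]_2) (a b : R) :
  tensor_dot m (tensor_sq (vec2 a b)) =
  a ^+ 2 * m 0 0 + 2 * (a * b) * m 0 1 + b ^+ 2 * m 1 1.
Proof. by rewrite /tensor_dot !mxE /=; ring. Qed.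

Lemma perp_vec2 (a b : R) : perp (vec2 a b) = vec2 (- b) a.
Proof. by rewrite /perp !mxE. Qed.

Context (r : R) (f : plane -> 'M[R]_2).
Context (hf : Cc2_sym_tensor (open_disc r) f).

Lemma Cc2_continuous i j : continuous (fun x => f x i j).
Proof. by have [C _] := hf.2 i j; exact: C.1. Qed.

Lemma Cc2_partial i j k (x : plane) :
  is_derive x (delta_mx 0 k) (fun x => f x i j)
    ('D_(delta_mx 0 k) (fun x => f x i j) x).
Proof. by have [[_ /(_ k)[D _]] _] := hf.2 i j; exact: derivableP. Qed.

Lemma Cc2_partial_continuous i j k :
  continuous ('D_(delta_mx 0 k) (fun x => f x i j)).
Proof. by have [[_ /(_ k)[_ C]] _] := hf.2 i j; exact: C.1. Qed.

Lemma Cc2_eq0 i j k (x : plane) : r <= x 0 k -> f x i j = 0.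
Proof.
by have [_ s] := hf.2 i j; exact: (supported_disc (h := fun x => f x i j)).
Qed.

Lemma dot_continuous (a : plane) :
  continuous (fun y => tensor_dot (f y) (tensor_sq a)).
Proof.
have -> : (fun y => tensor_dot (f y) (tensor_sq a)) =
    (fun y => (tensor_sq a 0 0 * f y 0 0 + 2 * tensor_sq a 0 1 * f y 0 1) +
              tensor_sq a 1 1 * f y 1 1).
  by apply/funext => y; rewrite /tensor_dot; ring.
do 2?apply: continuous_add; apply: continuous_cmul; exact: Cc2_continuous.
Qed.

Lemma dot_ray_supported (a b : plane) : 0 < a 0 1 ->
  ray_supported a (fun y => tensor_dot (f y) (tensor_sq b)).
Proof.
move=> a0; apply: (@ray_supported_above _ r) => // x rx.
by rewrite /tensor_dot !(Cc2_eq0 _ _ rx); ring.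
Qed.

End Tensor.

Theorem theorem7 (R : realType) (r1 : R) (r1_gt0 : 0 < r1)
    (u1 u2 : R) (u1_gt0 : 0 < u1) (u2_gt0 : 0 < u2)
    (u_unit : u1 ^+ 2 + u2 ^+ 2 = 1) (u1_neq_u2 : u1 <> u2)
    (f g : 'rV[R]_2 -> 'M[R]_2)
    (f_Cc2 : Cc2_sym_tensor (open_disc r1) f)
    (g_Cc2 : Cc2_sym_tensor (open_disc r1) g)
    (eqL : forall x, longitudinal (vec2 u1 u2) (vec2 (- u1) u2) f x =
                     longitudinal (vec2 u1 u2) (vec2 (- u1) u2) g x)
    (eqL1 : forall x, longitudinal1 (vec2 u1 u2) (vec2 (- u1) u2) f x =
                      longitudinal1 (vec2 u1 u2) (vec2 (- u1) u2) g x)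
    (eqT : forall x, transverse (vec2 u1 u2) (vec2 (- u1) u2) f x =
                     transverse (vec2 u1 u2) (vec2 (- u1) u2) g x) :
  f = g.
Proof.
pose u := vec2 u1 u2; pose v := vec2 (- u1) u2.
have u0 : 0 < u 0 1 by rewrite mxE.
have v0 : 0 < v 0 1 by rewrite mxE.
have cf := dot_continuous f_Cc2; have cg := dot_continuous g_Cc2.
have suf b := dot_ray_supported f_Cc2 b u0.
have sug b := dot_ray_supported g_Cc2 b u0.
have svf b := dot_ray_supported f_Cc2 b v0.
have svg b := dot_ray_supported g_Cc2 b v0.
pose F i j : 'rV[R]_2 -> R := (fun x => f x i j) - (fun x => g x i j).
have [dF cdF FD] : exists2 dF : 'I_2 -> 'I_2 -> 'I_2 -> 'rV[R]_2 -> R,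
    forall k i j, continuous (dF k i j) &
    forall k i j x, is_derive x (delta_mx 0 k) (F i j) (dF k i j x).
  exists (fun k i j => 'D_(delta_mx 0 k) (fun x => f x i j) -
                       'D_(delta_mx 0 k) (fun x => g x i j)) => k i j.
    exact: (continuous_sub (@Cc2_partial_continuous _ _ _ f_Cc2 i j k)
      (@Cc2_partial_continuous _ _ _ g_Cc2 i j k)).
  by move=> x; exact: (is_deriveB (Cc2_partial f_Cc2 i j k x)
    (Cc2_partial g_Cc2 i j k x)).
have F0 k i j (x : 'rV[R]_2) : r1 <= x 0 k -> F i j x = 0.
  move=> rx; rewrite /F !fctE.
  by rewrite (Cc2_eq0 f_Cc2 _ _ rx) (Cc2_eq0 g_Cc2 _ _ rx) subrr.
have DF i j a b x :
    is_derive x (vec2 a b) (F i j) (a * dF 0 i j x + b * dF 1 i j x).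
  exact: is_derive_vec2.
have cab i j a b c : continuous (fun x => c * (a * dF 0 i j x + b * dF 1 i j x)).
  apply: continuous_cmul; apply: continuous_add; apply: continuous_cmul;
    exact: cdF.
(* The left-hand side is half of P + Q. *)
have A0 x : u1 ^+ 2 * F 0 0 x + u2 ^+ 2 * F 1 1 x = 0.
  have := vline_moments_sum (cf _) (cg _) (cf _) (cg _) (suf _) (sug _) (svf _)
    (svg _) eqL eqL1 x.
  rewrite !tensor_dot_sq /F !fctE; lra.
(* If P = c F_ij and Q = c' F_ij, then D_v P + D_u Q = 0 reads as stated, since
   D_u = u1 d/dx1 + u2 d/dx2 and D_v = - u1 d/dx1 + u2 d/dx2. *)
have transport b b' i j c c' :
    (forall x, moment_beam 0 u (fun y => tensor_dot (f y) (tensor_sq b)) x +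
               moment_beam 0 v (fun y => tensor_dot (f y) (tensor_sq b')) x =
               moment_beam 0 u (fun y => tensor_dot (g y) (tensor_sq b)) x +
               moment_beam 0 v (fun y => tensor_dot (g y) (tensor_sq b')) x) ->
    (forall y, tensor_dot (f y) (tensor_sq b) - tensor_dot (g y) (tensor_sq b) =
               c * F i j y) ->
    (forall y, tensor_dot (f y) (tensor_sq b') - tensor_dot (g y) (tensor_sq b') =
               c' * F i j y) ->
    forall x, (c' - c) * (u1 * dF 0 i j x) + (c + c') * (u2 * dF 1 i j x) = 0.
  move=> eqb Eb Eb' x.
  transitivity (c * (- u1 * dF 0 i j x + u2 * dF 1 i j x) +
                c' * (u1 * dF 0 i j x + u2 * dF 1 i j x)); first by ring.
  have dfun a (k : R) y : is_derive y (vec2 a u2) (k \*: F i j)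
      (k * (a * dF 0 i j y + u2 * dF 1 i j y)).
    by apply: is_deriveZ; exact: DF.
  apply: (@vline_derive _ u v _ _ _ _ (cf b) (cg b) (cf b') (cg b') (suf b)
    (sug b) (svf b') (svg b') eqb _ _ _ _ (cab i j (- u1) u2 c)
    (cab i j u1 u2 c')) => y.
    have -> : (fun y => tensor_dot (f y) (tensor_sq b)) -
        (fun y => tensor_dot (g y) (tensor_sq b)) = c \*: F i j.
      by apply/funext => z; exact: Eb.
    exact: dfun.
  have -> : (fun y => tensor_dot (f y) (tensor_sq b')) -
      (fun y => tensor_dot (g y) (tensor_sq b')) = c' \*: F i j.
    by apply/funext => z; exact: Eb'.
  exact: dfun.
have u1n : u1 != 0 by rewrite gt_eqF.
have u2n : u2 != 0 by rewrite gt_eqF.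
(* By A0, P = - Q = 2 u1 u2 F12, so only d/dx1 survives in the transport
   equation. *)
have B0 : forall x, F 0 1 x = 0.
  apply: (eq0_derive_axis (i := 0) _ (F0 0 0 1)) => x.
  suff <- : dF 0 0 1 x = 0 by [].
  pose c := 2 * (u1 * u2).
  have c0 : - c - c != 0.
    by rewrite -opprD oppr_eq0 -mulr2n mulrn_eq0 /c !mulf_neq0// gt_eqF.
  have /(_ _ _ x)/eqP := transport u v 0 1 c (- c) eqL.
  rewrite subrr mul0r addr0 !mulf_eq0 (negPf c0) (negPf u1n) /= => E.
  by apply/eqP/E => y; rewrite !tensor_dot_sq /F !fctE;
    have := A0 y; rewrite /F !fctE /c; lra.
(* Once F12 = 0, both transverse components of F are u2^2 F11 + u1^2 F22, and
   only d/dx2 survives. By A0 and u1^2 + u2^2 = 1 this function is c F11. *)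
have C0 : forall x, F 0 0 x = 0.
  apply: (eq0_derive_axis (i := 1) _ (F0 1 0 0)) => x.
  suff <- : dF 1 0 0 x = 0 by [].
  pose c := (u2 ^+ 2 - u1 ^+ 2) / u2 ^+ 2.
  have c0 : c + c != 0.
    rewrite -mulr2n mulrn_eq0 /c mulf_neq0 ?invr_eq0 ?expf_neq0//.
    by rewrite subr_eq0 eqrXn2 ?ltW// eq_sym; exact/eqP.
  have /(_ _ _ x)/eqP := transport (perp u) (perp v) 0 0 c c eqT.
  rewrite subrr mul0r add0r !mulf_eq0 (negPf c0) (negPf u2n) /= => E.
  have cE y : c * F 0 0 y = u2 ^+ 2 * F 0 0 y + u1 ^+ 2 * F 1 1 y.
    apply: (mulfI (expf_neq0 2 u2n)).
    rewrite mulrA [_ * c]mulrC divfK ?expf_neq0//.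
    have A1 : u2 ^+ 2 * F 1 1 y = - (u1 ^+ 2 * F 0 0 y).
      by apply/eqP; rewrite -addr_eq0 addrC A0.
    transitivity (u2 ^+ 2 * u2 ^+ 2 * F 0 0 y + u1 ^+ 2 * (u2 ^+ 2 * F 1 1 y));
      last by ring.
    by rewrite A1 -[u2 ^+ 2 - u1 ^+ 2]mulr1 -u_unit; ring.
  by apply/eqP/E => y; rewrite /u /v !perp_vec2 !tensor_dot_sq cE /F !fctE;
    have := B0 y; rewrite /F !fctE => /subr0_eq ->; ring.
apply/funext => x; apply/matrixP => i j.
have D0 : F 1 1 x = 0.
  by apply: (mulfI (expf_neq0 2 u2n)); have := A0 x; rewrite C0 !mulr0 add0r.
apply/eqP; rewrite -subr_eq0; apply/eqP.
have [->|->] := ord2P i; have [->|->] := ord2P j.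
- exact: C0.
- exact: B0.
- rewrite -f_Cc2.1 -g_Cc2.1; exact: B0.
- exact: D0.
Qed.
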